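(* The worst case time complexity of each of the operations $s$ and $s'$ (defined in the context) on an input representing the natural number $n$ is $O(\log_2^*(n))$, where $\log_2^*$ is the iterated base-2 logarithm.
   Context: Let $T$ be the set of finite ordered rooted binary trees with empty leaves: $e$ is the empty tree and $c(x,y)$ is the tree with left subtree $x$ and right subtree $y$; $c'$ is the inverse of $c$ on nonempty trees. Put $u=c(e,e)$. Parity is defined recursively: $e$ is even; $c(x,y)$ is even iff $y$ is odd, and odd iff $y$ is even. A tree $t$ represents the natural number $N(t)$ given by $N(e)=0$ and $N(c(x,y))=2^{N(x)+1}N(y)$ if $N(y)$ is odd, $N(c(x,y))=2^{N(x)+1}(N(y)+1)-1$ if $N(y)$ is even; $N$ is a bijection $T\to\mathbb{N}$. The functions $s$ (on $T$) and $s'$ (on $T\setminus\{e\}$) are defined by mutual recursion; in each list the first applicable rule is used. Definition of $s$: $s(e)=u$; $s(c(x,e))=c(x,u)$; for an even argument $\neq e$: $s(c(e,c(x,y)))=c(s(x),y)$, and otherwise $s(c(x,y))=c(e,c(s'(x),y))$; for an odd argument: $s(c(x,c(e,c(y,z))))=c(x,c(s(y),z))$, and otherwise $s(c(x,c(y,z)))=c(x,c(e,c(s'(y),z)))$. Definition of $s'$: $s'(u)=e$; $s'(c(x,u))=c(x,e)$; for an even argument: $s'(c(x,c(e,c(y,z))))=c(x,c(s(y),z))$, and otherwise $s'(c(x,c(y,z)))=c(x,c(e,c(s'(y),z)))$; for an odd argument: $s'(c(e,c(x,z)))=c(s(x),z)$, and otherwise $s'(c(x,y))=c(e,c(s'(x),y))$.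 Cost model: applying $c$ or $c'$, testing equality with $e$ or $u$, and testing parity each take constant time, so the running time is, up to a constant factor, the total number of (recursive) calls to $s$ and $s'$ made during the evaluation, including the initial one. *)

(* Defs.v *)
From Stdlib Require Import Reals Lra Lia Arith ConstructiveEpsilon.

Inductive tree : Type :=
| e : tree
| c : tree -> tree -> tree.

Definition u : tree := c e e.

Fixpoint even_tree (t : tree) : bool :=
  match t with
  | e => true
  | c _ y => negb (even_tree y)
  end.

Fixpoint N (t : tree) : nat :=
  match t with
  | e => 0
  | c x y =>
      if Nat.odd (N y) then 2 ^ (N x + 1) * N y
      else 2 ^ (N x + 1) * (N y + 1) - 1
  end.

(** Running an operation gives [None] where it is undefined, and otherwise
    [Some (v, k)]: the value [v] and the number [k] of calls to [s] and [s']
    made during the evaluation, the initial call included. *)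
Definition outcome : Type := option (tree * nat).

Definition ret (v : tree) : outcome := Some (v, 1).

(** The current call makes one recursive call, with outcome [r], and builds
    its result from the value of that call by applying [f]. *)
Definition after (r : outcome) (f : tree -> tree) : outcome :=
  match r with
  | Some (v, k) => Some (f v, S k)
  | None => None
  end.

Fixpoint s (t : tree) : outcome :=
  match t with
  | e => ret u
  | c x e => ret (c x u)
  | _ =>
      if even_tree t then
        match t with
        | c e (c x y) => after (s x) (fun x' => c x' y)
        | c x y => after (s' x) (fun x' => c e (c x' y))
        | e => None
        end
      else
        match t with
        | c x (c e (c y z)) => after (s y) (fun y' => c x (c y' z))
        | c x (c y z) => after (s' y) (fun y' => c x (c e (c y' z)))
        | _ => None
        end
  end
with s' (t : tree) : outcome :=
  match t with
  | c e e => ret e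
  | c x (c e e) => ret (c x e)
  | _ =>
      if even_tree t then
        match t with
        | c x (c e (c y z)) => after (s y) (fun y' => c x (c y' z))
        | c x (c y z) => after (s' y) (fun y' => c x (c e (c y' z)))
        | _ => None
        end
      else
        match t with
        | c e (c x z) => after (s x) (fun x' => c x' z)
        | c x y => after (s' x) (fun x' => c e (c x' y))
        | e => None
        end
  end.

Definition log2 (x : R) : R := (ln x / ln 2)%R.

Lemma log2_iter_le_1 (n : nat) : exists k, (Nat.iter k log2 (INR n) <= 1)%R.
Proof.
  assert (H : forall m x, (x <= INR m)%R -> exists k, (Nat.iter k log2 x <= 1)%R).
  { induction m as [|m IH]; intros x Hx.
    - exists 0. simpl in *. lra.
    - destruct (Rle_dec x 2) as [H2|H2].
      + destruct (Rle_dec x 1) as [H1|H1]; [exists 0; exact H1|].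
        exists 1. simpl. unfold log2.
        assert (Hln : (ln x <= ln 2)%R).
        { destruct (Req_dec x 2) as [->|Hne]; [lra|].
          apply Rlt_le, ln_increasing; lra. }
        pose proof ln_lt_2. apply Rmult_le_reg_r with (ln 2); [lra|].
        replace (ln x / ln 2 * ln 2)%R with (ln x) by (field; lra). lra.
      + assert (Hstep : (log2 x <= x - 1)%R).
        { unfold log2. pose proof ln_lt_2.
          apply Rmult_le_reg_r with (ln 2); [lra|].
          replace (ln x / ln 2 * ln 2)%R with (ln x) by (field; lra).
          replace x with (2 * (x / 2))%R at 1 by field.
          rewrite ln_mult by lra.
          assert (ln (x / 2) <= x / 2 - 1)%R.
          { pose proof (exp_ineq1_le (ln (x / 2))) as Hexp.
            rewrite exp_ln in Hexp by lra. lra. }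
          nra. }
        rewrite S_INR in Hx.
        destruct (IH (log2 x)) as [k Hk]; [lra|].
        exists (S k). rewrite Nat.iter_succ_r. exact Hk. }
  exact (H n (INR n) (Rle_refl _)).
Qed.

Definition log2_star_sig (n : nat) :
  {k : nat | (Nat.iter k log2 (INR n) <= 1)%R /\
             forall j, (Nat.iter j log2 (INR n) <= 1)%R -> k <= j} :=
  epsilon_smallest _ (fun k => Rle_dec (Nat.iter k log2 (INR n)) 1) (log2_iter_le_1 n).

(** The least number of applications of the real base-2 logarithm that takes
    [n] to a value at most 1. *)
Definition log2_star (n : nat) : nat := proj1_sig (log2_star_sig n).

(** The worst-case time of the operation [op], whose inputs are the trees in
    [dom], is O(g(n)) on inputs representing [n]; every input in [dom],
    however small, must have a defined outcome. The bound is asked only for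
    [n >= n0] since [g], like the iterated logarithm, may vanish at small [n]. *)
Definition worst_case_time_O
    (op : tree -> outcome) (dom : tree -> Prop) (g : nat -> nat) : Prop :=
  exists K n0 : nat, forall (n : nat) (t : tree), dom t -> N t = n ->
    exists (v : tree) (k : nat),
      op t = Some (v, k) /\ (n0 <= n -> k <= K * g n).

(* Main.v *)
(** Every rule of [s] and [s'] makes at most one recursive call, on a subtree
    [w] occurring as the left child of a subtree of the argument [t].  The
    nonempty tree [c x y] represents a number at least [2 ^ N x] and at least
    [N y], hence [2 ^ N w <= N t]: each call takes a base-2 logarithm of the
    represented number. *)
From Stdlib Require Import Reals Lra Lia Arith.
Require Import Defs.

Lemma N_c_ge_pow (x y : tree) : 2 ^ N x <= N (c x y).
Proof.
  cbn [N]. rewrite Nat.add_1_r, Nat.pow_succ_r'.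
  pose proof (Nat.pow_nonzero 2 (N x)).
  destruct (Nat.odd (N y)) eqn:E; [|nia].
  (* An odd [N y] is nonzero, so the product keeps the factor [2 ^ N x]. *)
  destruct (N y); [discriminate E | nia].
Qed.

Lemma N_c_ge_right (x y : tree) : N y <= N (c x y).
Proof.
  cbn [N]. pose proof (Nat.pow_nonzero 2 (N x + 1)).
  destruct (Nat.odd (N y)); nia.
Qed.

Lemma N_c_c_ge_pow (x y z : tree) : 2 ^ N y <= N (c x (c y z)).
Proof.
  exact (Nat.le_trans _ _ _ (N_c_ge_pow y z) (N_c_ge_right x (c y z))).
Qed.

Lemma N_c_c_c_ge_pow (x y z w : tree) : 2 ^ N z <= N (c x (c y (c z w))).
Proof.
  exact (Nat.le_trans _ _ _ (N_c_c_ge_pow y z w) (N_c_ge_right x _)).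
Qed.

(** All that the cost analysis needs to know about the rules. The guard [w <> e] is there because
    [s'] is undefined at [e]. *)
Definition one_step (t : tree) (r : outcome) : Prop :=
  (exists v, r = ret v) \/
  (exists w f, 2 ^ N w <= N t /\
    (r = after (s w) f \/ w <> e /\ r = after (s' w) f)).

(** The three bounds cover a left child taken after 0, 1 or 2 steps to the right. For a call of
    [s'], [w0] must have the form [c _ _], so that [discriminate] shows it nonempty. *)
Ltac recurse_on w0 :=
  right; exists w0; eexists; split;
  [ first [apply N_c_ge_pow | apply N_c_c_ge_pow | apply N_c_c_c_ge_pow]
  | first [ left; reflexivity | right; split; [discriminate | reflexivity] ] ].

Lemma s_one_step (t : tree) : one_step t (s t).
Proof.
  destruct t as [|x [|y z]]; [left; eexists; reflexivity ..|].
  unfold one_step. cbn [s]. destruct (even_tree (c x (c y z))) eqn:E.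
  - destruct x as [|x1 x2]; [recurse_on y | recurse_on (c x1 x2)].
  - destruct y as [|y1 y2]; [|recurse_on (c y1 y2)].
    destruct z as [|z1 z2]; [discriminate E | recurse_on z1].
Qed.

Lemma s'_one_step (t : tree) : t <> e -> one_step t (s' t).
Proof.
  intros Ht. destruct t as [|x [|y z]]; [easy| |].
  - destruct x as [|x1 x2]; [left; eexists; reflexivity|].
    recurse_on (c x1 x2).
  - destruct (even_tree (c x (c y z))) eqn:E.
    + destruct y as [|y1 y2].
      * destruct z as [|z1 z2].
        -- left. exists (c x e). destruct x; reflexivity.
        (* The base rules of [s'] inspect [x] first, so the match reduces only after [x] is split,
           although both cases reach the same rule. *)
        -- assert (H : s' (c x (c e (c z1 z2)))
              = after (s z1) (fun y' => c x (c y' z2)))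
             by (cbn [s']; rewrite E; destruct x; reflexivity).
           rewrite H. recurse_on z1.
      * assert (H : s' (c x (c (c y1 y2) z))
              = after (s' (c y1 y2)) (fun y' => c x (c e (c y' z))))
          by (cbn [s']; rewrite E; destruct x; reflexivity).
        rewrite H. recurse_on (c y1 y2).
    (* The base rule for [c x u] cannot fire on an odd argument, since [c x u] is even. *)
    + assert (Hu : c y z <> u) by (intros [= -> ->]; discriminate E).
      destruct x as [|x1 x2].
      * assert (H : s' (c e (c y z)) = after (s y) (fun x' => c x' z))
          by (cbn [s']; rewrite E; destruct y, z; easy).
        rewrite H. recurse_on y.
      * assert (H : s' (c (c x1 x2) (c y z))
              = after (s' (c x1 x2)) (fun x' => c e (c x' (c y z))))
          by (cbn [s']; rewrite E; destruct y, z; easy).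
        rewrite H. recurse_on (c x1 x2).
Qed.

Lemma log2_le (x y : R) : (0 < x -> x <= y -> log2 x <= log2 y)%R.
Proof.
  intros Hx Hxy. pose proof ln_lt_2. unfold log2, Rdiv.
  apply Rmult_le_compat_r; [apply Rlt_le, Rinv_0_lt_compat; lra|].
  destruct Hxy as [Hxy| ->]; [apply Rlt_le, ln_increasing; lra | lra].
Qed.

(* The count for [x] may have to be smaller: once at most 1, the iterates soon
   leave the domain of [log2], where it is no longer monotone. *)
Lemma iter_log2_le_1_anti (j : nat) (x y : R) :
  (x <= y)%R -> (Nat.iter j log2 y <= 1)%R ->
  exists i, i <= j /\ (Nat.iter i log2 x <= 1)%R.
Proof.
  revert x y. induction j as [|j IH]; intros x y Hxy Hy.
  - exists 0. simpl in *. split; [lia | lra].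
  - destruct (Rle_dec x 1) as [Hx|Hx]; [exists 0; split; [lia | exact Hx]|].
    rewrite Nat.iter_succ_r in Hy.
    destruct (IH (log2 x) (log2 y)) as (i & Hi & Hxi); [|exact Hy|].
    + apply log2_le; lra.
    + exists (S i). rewrite Nat.iter_succ_r. split; [lia | exact Hxi].
Qed.

(** As [2 <= n], the count for [n] is positive. Dropping its first logarithm leaves a count for
    [log2 n], and [m <= log2 n]. *)
Lemma log2_star_pow_le (m n : nat) :
  2 <= n -> 2 ^ m <= n -> S (log2_star m) <= log2_star n.
Proof.
  intros Hn Hmn. unfold log2_star.
  destruct (log2_star_sig m) as (a & Ha & Hmin).
  destruct (log2_star_sig n) as (b & Hb & Hbmin). simpl.
  apply le_INR in Hn, Hmn. rewrite pow_INR in Hmn.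
  change (INR 2) with 2%R in *.
  destruct b as [|b]; [simpl in Hb; lra|].
  rewrite Nat.iter_succ_r in Hb.
  destruct (iter_log2_le_1_anti b (INR m) (log2 (INR n))) as (i & Hi & Hmi);
    [|exact Hb|specialize (Hmin i Hmi); lia].
  replace (INR m) with (log2 (2 ^ m)).
  - apply log2_le; [apply pow_lt; lra | exact Hmn].
  - pose proof ln_lt_2. unfold log2. rewrite ln_pow by lra. field. lra.
Qed.

Definition halts_within (r : outcome) (b : nat) : Prop :=
  exists v k, r = Some (v, k) /\ k <= b.

Lemma halts_within_after (r : outcome) (f : tree -> tree) (a b : nat) :
  halts_within r a -> a < b -> halts_within (after r f) b.
Proof.
  intros (v & k & -> & Hk) Hab. exists (f v), (S k). split; [reflexivity | lia].
Qed.

(** Both operations are treated at once because they call each other. Strong induction on [N t]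
    applies since [N w < 2 ^ N w <= N t]. *)
Lemma halts_within_log2_star (t : tree) :
  halts_within (s t) (log2_star (N t) + 2) /\
  (t <> e -> halts_within (s' t) (log2_star (N t) + 2)).
Proof.
  induction t as [t IH] using (induction_ltof1 _ N). unfold ltof in IH.
  assert (step : forall r, one_step t r ->
            halts_within r (log2_star (N t) + 2)).
  { intros r [(v & ->) | (w & f & Hw & Hr)].
    - exists v, 1. split; [reflexivity | lia].
    - assert (Hlt : N w < N t)
        by (pose proof (Nat.pow_gt_lin_r 2 (N w)); lia).
      destruct (IH w Hlt) as [IHs IHs'].
      destruct (le_lt_dec 2 (N t)) as [H2|H2].
      + pose proof (log2_star_pow_le _ _ H2 Hw).
        destruct Hr as [-> | [Hwe ->]];
          eapply halts_within_after; eauto; lia.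
      (* For [N t < 2] the iterated logarithm pays for no call. But then [N w = 0], so [w = e] and
         only [s e] can follow: two calls, whence the constant 2. *)
      + destruct w as [|x y].
        * destruct Hr as [-> | [[] _]]; [|reflexivity].
          eexists _, 2. split; [reflexivity | lia].
        * pose proof (N_c_ge_pow x y). pose proof (Nat.pow_nonzero 2 (N x)). lia. }
  split; [|intros Ht]; apply step; auto using s_one_step, s'_one_step.
Qed.

Lemma worst_case_time_O_log2_star (op : tree -> outcome) (dom : tree -> Prop) :
  (forall t, dom t -> halts_within (op t) (log2_star (N t) + 2)) ->
  worst_case_time_O op dom log2_star.
Proof.
  (* From 2 on [log2_star] is at least 1, so adding 2 at most triples it. *)
  intros H. exists 3, 2. intros n t Ht <-.
  destruct (H t Ht) as (v & k & Hop & Hk). exists v, k. split; [exact Hop|].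
  intros Hn. pose proof (log2_star_pow_le 0 (N t) Hn). simpl in *. lia.
Qed.

Theorem proposition5 :
  worst_case_time_O s (fun _ => True) log2_star /\
  worst_case_time_O s' (fun t => t <> e) log2_star.
Proof.
  split; apply worst_case_time_O_log2_star; intros t Ht.
  - apply halts_within_log2_star.
  - apply halts_within_log2_star, Ht.
Qed.
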